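(* Suppose a group $G$ acts geometrically on a proper CAT(0) space $X$. Then for every $x_0\in X$ and every $A>0$, the linearly controlled dimension of the metric space $(\partial X,d_{A,x_0})$ is finite: $\ell\text{-}\dim(\partial X,d_{A,x_0})<\infty$.
   Context: A group acts geometrically if it acts properly and cocompactly by isometries. Geodesic rays are parametrized by arc length on $[0,\infty)$. The boundary $\partial X$ of a proper CAT(0) space $(X,d)$ is the set of equivalence classes of geodesic rays, where rays $\alpha,\alpha'$ are equivalent (asymptotic) if there is a constant $k$ with $d(\alpha(t),\alpha'(t))\le k$ for all $t\ge 0$. For each base point $x_0$, each class has a unique representative ray starting at $x_0$. For $x_0\in X$ and $A>0$, the metric $d_{A,x_0}$ on $\partial X$ is defined as follows: given $[\alpha],[\beta]\in\partial X$ with representative rays $\alpha,\beta$ based at $x_0$, let $a\in(0,\infty)$ be such that $d(\alpha(a),\beta(a))=A$, and set $a=\infty$ if no such $a$ exists; then $d_{A,x_0}([\alpha],[\beta])=1/a$ (with $1/\infty=0$). For a cover $\mathcal U$ of a metric space $Y$: $\mathrm{mesh}(\mathcal U)=\sup\{\mathrm{diam}(U): U\in\mathcal U\}$; the order of $\mathcal U$ is the smallest integer $m$ such that each point of $Y$ lies in at most $m$ elements of $\mathcal U$; the Lebesgue number is $\mathcal L(\mathcal U)=\inf_{y\in Y}\sup\{d(y,Y-U): U\in\mathcal U\}$ (distance to the empty set is $+\infty$). The linearly controlled dimension of $Y$ is at most $n$, written $\ell\text{-}\dim Y\le n$, if there exist $c\ge 1$ and $\lambda_0>0$ such that for all $0<\lambda\le\lambda_0$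 there is a uniformly bounded open cover $\mathcal U$ of $Y$ with $\mathcal L(\mathcal U)\ge\lambda$, $\mathrm{mesh}(\mathcal U)\le c\lambda$ and order at most $n+1$. *)

(* Defs.v *)
From HB Require Import structures.
From mathcomp Require Import all_boot all_order all_algebra.
From mathcomp Require Import all_classical all_reals all_analysis.
From mathcomp Require Import ring lra.

Set Implicit Arguments.
Unset Strict Implicit.
Unset Printing Implicit Defensive.

Import Order.TTheory GRing.Theory Num.Theory.
Import numFieldNormedType.Exports.

Local Open Scope classical_set_scope.
Local Open Scope ring_scope.

(** * Proper CAT(0) spaces *)

Section CAT0.
Context {R : realType}.

(* The norm of ['rV[R]_2] in the library is the sup norm. *)
Definition eucl_dist (p q : 'rV[R]_2) : R :=
  Num.sqrt (\sum_i (p 0 i - q 0 i) ^+ 2).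

Variable X : metricType R.
Implicit Types x y : X.

Definition proper_space : Prop :=
  forall x (r : R), compact [set y | mdist x y <= r].

(* Only the values of [c] on [0, d(x, y)] are relevant. *)
Definition geodesic x y (c : R -> X) : Prop :=
  [/\ c 0 = x, c (mdist x y) = y &
      forall s t, 0 <= s <= mdist x y -> 0 <= t <= mdist x y ->
        mdist (c s) (c t) = `|s - t|].

Definition geodesic_space : Prop := forall x y, exists c, geodesic x y c.

(* The point of the Euclidean segment [p, q] at distance [s] from [p]. *)
Definition comparison_point (p q : 'rV[R]_2) (s : R) (z : 'rV[R]_2) : Prop :=
  eucl_dist p z = s /\
  exists2 u : R, 0 <= u <= 1 & z = (1 - u) *: p + u *: q.

(* A geodesic triangle has vertices [v i] and sides [c i] from [v i] to
   [v (ordS i)], where [ordS] is the cyclic successor on ['I_3]. *)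
Definition geodesic_triangle (v : 'I_3 -> X) (c : 'I_3 -> R -> X) : Prop :=
  forall i, geodesic (v i) (v (ordS i)) (c i).

Definition comparison_triangle (v : 'I_3 -> X) (w : 'I_3 -> 'rV[R]_2) : Prop :=
  forall i, eucl_dist (w i) (w (ordS i)) = mdist (v i) (v (ordS i)).

Definition CAT0_inequality (v : 'I_3 -> X) (c : 'I_3 -> R -> X) : Prop :=
  forall w, comparison_triangle v w ->
  forall (i j : 'I_3) (s t : R) (zs zt : 'rV[R]_2),
    0 <= s <= mdist (v i) (v (ordS i)) ->
    0 <= t <= mdist (v j) (v (ordS j)) ->
    comparison_point (w i) (w (ordS i)) s zs ->
    comparison_point (w j) (w (ordS j)) t zt ->
    mdist (c i s) (c j t) <= eucl_dist zs zt.

Definition CAT0_space : Prop :=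
  geodesic_space /\
  forall v c, geodesic_triangle v c -> CAT0_inequality v c.

End CAT0.

Arguments proper_space {R} X.
Arguments geodesic_space {R} X.
Arguments CAT0_space {R} X.

(** * Geometric actions *)

Section geometric_action.
Context {R : realType} {X : metricType R} {G : groupType}.
Variable act : G -> X -> X.

Definition group_action : Prop :=
  (forall x, act 1%g x = x) /\
  (forall g h x, act (g * h)%g x = act g (act h x)).

Definition isometric_action : Prop :=
  forall g x y, mdist (act g x) (act g y) = mdist x y.

(* The open balls [ball x r] may depend on [x]; on a proper space this amounts to
   finiteness of [{g | gK meets K}] for every compact [K]. *)
Definition proper_action : Prop :=
  forall x, exists2 r : R, 0 < r &
    finite_set [set g | (act g @` ball x r) `&` ball x r !=set0].

Definition cocompact_action : Prop :=
  exists2 K : set X, compact K & \bigcup_g (act g @` K) = setT.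

Definition geometric_action : Prop :=
  [/\ group_action, isometric_action, proper_action & cocompact_action].

End geometric_action.

(** * The boundary *)

(* Only the values on [0, +oo[ are relevant; in particular two rays that agree
   there are asymptotic. *)
Record geodesic_ray {R : realType} (X : metricType R) := GeodesicRay {
  ray_fun :> R -> X ;
  ray_isometric : forall s t, 0 <= s -> 0 <= t ->
    mdist (ray_fun s) (ray_fun t) = `|s - t| }.

HB.instance Definition _ (R : realType) (X : metricType R) :=
  gen_eqMixin (geodesic_ray X).
HB.instance Definition _ (R : realType) (X : metricType R) :=
  gen_choiceMixin (geodesic_ray X).

Section boundary.
Context {R : realType}.
Variable X : metricType R.
Implicit Types a b : geodesic_ray X.

Definition asymptotic a b : Prop :=
  exists k : R, forall t, 0 <= t -> mdist (a t) (b t) <= k.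

Lemma asymptotic_refl : reflexive (fun a b => `[< asymptotic a b >]).
Proof. by move=> a; apply/asboolP; exists 0 => t _; rewrite mdistxx. Qed.

Lemma asymptotic_sym : symmetric (fun a b => `[< asymptotic a b >]).
Proof.
by move=> a b; apply/asboolP/asboolP => -[k H]; exists k => t t0;
  rewrite metric_sym H.
Qed.

Lemma asymptotic_trans : transitive (fun a b => `[< asymptotic a b >]).
Proof.
move=> b a c /asboolP[k H] /asboolP[l K]; apply/asboolP; exists (k + l) => t t0.
by rewrite (le_trans (metric_triangle _ (b t) _))// lerD ?H ?K.
Qed.

Definition asymptotic_equiv :=
  EquivRel (fun a b => `[< asymptotic a b >])
    asymptotic_refl asymptotic_sym asymptotic_trans.

Definition boundary := {eq_quot asymptotic_equiv}%qT.

HB.instance Definition _ := Choice.on boundary.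
HB.instance Definition _ := EqQuotient.on boundary.

Definition ray_class a : boundary := \pi_boundary%qT a.

Lemma ray_classP a b : ray_class a = ray_class b <-> asymptotic a b.
Proof. by split=> [/eqquotP/asboolP//|ab]; apply/eqquotP/asboolP. Qed.

(* In a proper CAT(0) space every class has a ray based at [x0]
   ([based_rayP]), unique on [0, +oo[ ([based_ray_unique]). *)
Definition based_ray (x0 : X) (xi : boundary) : geodesic_ray X :=
  xget (repr xi) [set a : geodesic_ray X | a 0 = x0 /\ ray_class a = xi].

(* The [t] in ]0, +oo[ with [d(a(t), b(t)) = A], unique in a CAT(0) space
   ([separation_time_unique]), and [+oo] if there is none. *)
Definition separation_time (A : R) a b : \bar R :=
  xget +oo%E [set t%:E | t in [set t | 0 < t /\ mdist (a t) (b t) = A]].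

Definition visual_dist (x0 : X) (A : R) (xi eta : boundary) : R :=
  fine (separation_time A (based_ray x0 xi) (based_ray x0 eta))^-1%E.

End boundary.

(** * [visual_dist] is a metric *)

Section comparison.
Context {R : realType}.
Implicit Types p q z w : 'rV[R]_2.

Definition vec2 (x y : R) : 'rV[R]_2 := \row_i if i == 0 then x else y.

Lemma eucl_dist_vec2 (a b c d : R) :
  eucl_dist (vec2 a b) (vec2 c d) = Num.sqrt ((a - c) ^+ 2 + (b - d) ^+ 2).
Proof. by rewrite /eucl_dist !big_ord_recl big_ord0 !mxE/= addr0. Qed.

Lemma eucl_dist_scale p q p' q' (u : R) : 0 <= u ->
  p' - q' = u *: (p - q) -> eucl_dist p' q' = u * eucl_dist p q.
Proof.
move=> u0 /rowP H; rewrite /eucl_dist -[X in X * _](ger0_norm u0) -sqrtr_sqr.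
rewrite -sqrtrM ?sqr_ge0// mulr_sumr; congr Num.sqrt; apply: eq_bigr => i _.
by have := H i; rewrite !mxE => ->; rewrite exprMn.
Qed.

Lemma eucl_distC p q : eucl_dist p q = eucl_dist q p.
Proof.
by rewrite /eucl_dist; congr Num.sqrt; apply: eq_bigr => i _; rewrite -sqrrN opprB.
Qed.

Lemma euclidean_triangle (a b c : R) : 0 <= a -> 0 <= b -> 0 <= c ->
  a <= b + c -> b <= a + c -> c <= a + b ->
  exists p q r, [/\ eucl_dist p q = a, eucl_dist q r = b & eucl_dist r p = c].
Proof.
move=> a0 b0 c0 abc bac cab; have [a_eq0|a_neq0] := eqVneq a 0.
  have bc : b = c by lra.
  exists (vec2 0 0), (vec2 0 0), (vec2 b 0); rewrite !eucl_dist_vec2.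
  by rewrite !subr0 !sub0r !sqrrN expr0n/= addr0 !addr0 sqrtr0 !sqrtr_sqr !ger0_norm// a_eq0 -bc.
have a_gt0 : 0 < a by rewrite lt0r a_neq0.
pose x := (a ^+ 2 + c ^+ 2 - b ^+ 2) / (2 * a).
have xE : 2 * a * x = a ^+ 2 + c ^+ 2 - b ^+ 2 by rewrite /x; field.
have y2 : 0 <= c ^+ 2 - x ^+ 2.
  rewrite -(@pmulr_rge0 _ (4 * a ^+ 2)) ?mulr_gt0 ?exprn_gt0//.
  have -> : 4 * a ^+ 2 * (c ^+ 2 - x ^+ 2) = 4 * a ^+ 2 * c ^+ 2 - (2 * a * x) ^+ 2 by ring.
  rewrite xE.
  have -> : 4 * a ^+ 2 * c ^+ 2 - (a ^+ 2 + c ^+ 2 - b ^+ 2) ^+ 2 =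
    ((b + c - a) * (a + c - b)) * ((a + b - c) * (a + b + c)) by ring.
  by rewrite !mulr_ge0//; lra.
pose y := Num.sqrt (c ^+ 2 - x ^+ 2).
have yE : y ^+ 2 = c ^+ 2 - x ^+ 2 by rewrite sqr_sqrtr.
exists (vec2 0 0), (vec2 a 0), (vec2 x y); rewrite !eucl_dist_vec2; split.
- by rewrite sub0r subrr expr0n/= addr0 sqrrN sqrtr_sqr ger0_norm.
- rewrite sub0r sqrrN yE.
  have -> : (a - x) ^+ 2 + (c ^+ 2 - x ^+ 2) = b ^+ 2.
    have -> : (a - x) ^+ 2 + (c ^+ 2 - x ^+ 2) = a ^+ 2 + c ^+ 2 - 2 * a * x by ring.
    by rewrite xE; ring.
  by rewrite sqrtr_sqr ger0_norm.
- by rewrite !subr0 yE addrC subrK sqrtr_sqr ger0_norm.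
Qed.

End comparison.

Section thales.
Context {R : realType} {X : metricType R}.
Implicit Types x y p q r : X.

Lemma geodesic_rev x y c : geodesic x y c ->
  geodesic y x (fun t => c (mdist x y - t)).
Proof.
move=> [c0 cd ci]; split; rewrite ?subr0// metric_sym ?subrr// => s t s0 t0.
rewrite ci; last 2 first; [lra|lra|].
by rewrite distrC; congr (`|_|); ring.
Qed.

Lemma CAT0_thales p q r (c d : R -> X) (u : R) : CAT0_space X ->
  geodesic p q c -> geodesic p r d -> 0 <= u <= 1 ->
  mdist (c (u * mdist p q)) (d (u * mdist p r)) <= u * mdist q r.
Proof.
move=> [gX cX] gc gd /andP[u0 u1].
have [e ge] := gX q r.
pose v := tnth [tuple p; q; r].
pose k := tnth [tuple c; e; (fun t => d (mdist p r - t))].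
have vk : geodesic_triangle v k.
  case=> [[|[|[|//]]] ?].
  - by rewrite /v /k !(tnth_nth p) !(tnth_nth c).
  - by rewrite /v /k !(tnth_nth p) !(tnth_nth c).
  - by rewrite /v /k !(tnth_nth p) !(tnth_nth c)/=; apply: geodesic_rev.
have [wp [wq [wr [pq qr rp]]]] :
    exists wp wq wr : 'rV[R]_2, [/\ eucl_dist wp wq = mdist p q,
      eucl_dist wq wr = mdist q r & eucl_dist wr wp = mdist r p].
  have := (metric_triangle p r q, metric_triangle q p r, metric_triangle r q p).
  rewrite (metric_sym q p) (metric_sym p r) (metric_sym r q) => -[[? ?] ?].
  by apply: euclidean_triangle; rewrite ?mdist_ge0//; lra.
pose w := tnth [tuple wp; wq; wr].
have vw : comparison_triangle v w.
  by case=> [[|[|[|//]]] ?]; rewrite /v /w !(tnth_nth p) !(tnth_nth wp).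
have := cX v k vk w vw ord0 ord_max (u * mdist p q) (mdist p r - u * mdist p r)
  ((1 - u) *: wp + u *: wq) ((1 - (1 - u)) *: wr + (1 - u) *: wp).
rewrite /v /w /k !(tnth_nth p) !(tnth_nth wp) !(tnth_nth c)/=.
have d1 := mdist_ge0 p q; have d2 := mdist_ge0 p r.
rewrite (_ : mdist p r - (mdist p r - u * mdist p r) = u * mdist p r); last by ring.
rewrite (@eucl_dist_scale _ wq wr _ _ u)//; last first.
  by apply/rowP => i; rewrite !mxE; ring.
rewrite qr; apply.
- by rewrite mulr_ge0//= ler_piMl.
- by rewrite (metric_sym r p) subr_ge0 ler_piMl//= lerBlDr lerDl mulr_ge0.
- split.
    rewrite (@eucl_dist_scale _ wp wq _ _ u) ?pq//.
    by apply/rowP => i; rewrite !mxE; ring.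
  by exists u => //; rewrite u0.
- split.
    rewrite (@eucl_dist_scale _ wr wp _ _ (1 - u)) ?rp ?subr_ge0//.
      by rewrite (metric_sym r p); ring.
    by apply/rowP => i; rewrite !mxE; ring.
  by exists (1 - u) => //; apply/andP; split; lra.
Qed.

End thales.

Section rays.
Context {R : realType} {X : metricType R}.
Implicit Types (x : X) (a b : geodesic_ray X).

Lemma ray_geodesic a (t : R) : 0 <= t -> geodesic (a 0) (a t) a.
Proof.
move=> t0; have dt : mdist (a 0) (a t) = t.
  by rewrite ray_isometric// sub0r normrN ger0_norm.
split; rewrite ?dt// => r s /andP[r0 _] /andP[s0 _]; exact: ray_isometric.
Qed.

Lemma ray_dist_scale a b (s t : R) : CAT0_space X -> a 0 = b 0 ->
  0 <= s <= t -> t * mdist (a s) (b s) <= s * mdist (a t) (b t).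
Proof.
move=> cX ab /andP[s0 st]; have t0 := le_trans s0 st.
have [t_eq0|t_neq0] := eqVneq t 0.
  have -> : s = t by lra.
  by [].
have t_gt0 : 0 < t by rewrite lt0r t_neq0.
have gb := ray_geodesic b t0; rewrite -ab in gb.
have u01 : 0 <= s / t <= 1 by rewrite divr_ge0//= ler_pdivrMr// mul1r.
have := CAT0_thales cX (ray_geodesic a t0) gb u01.
rewrite {2}ab !ray_isometric// sub0r normrN ger0_norm// divfK// => H.
by rewrite -ler_pdivlMl// mulrA [_^-1 * _]mulrC.
Qed.

Lemma based_ray_unique a b : CAT0_space X -> a 0 = b 0 -> asymptotic a b ->
  forall t, 0 <= t -> a t = b t.
Proof.
move=> cX ab [k H] t t0; apply: mdist_positivity.
apply/eqP; rewrite eq_le mdist_ge0 andbT leNgt; apply/negP => m0.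
set m := mdist _ _ in m0.
have k0 : 0 <= k by rewrite (le_trans (mdist_ge0 _ _) (H 0 _)).
pose s := t + t * k / m + 1.
have tkm : 0 <= t * k / m by rewrite divr_ge0 ?mulr_ge0// ltW.
have := @ray_dist_scale a b t s cX ab; rewrite t0 /= -/m => H'.
have /H' : t <= s by rewrite /s; lra.
apply/negP; rewrite -ltNge (@le_lt_trans _ _ (t * k))//.
  by rewrite ler_wpM2l// H// /s; lra.
rewrite /s !mulrDl divfK ?gt_eqF// mul1r.
by have := mulr_ge0 t0 (ltW m0); lra.
Qed.

Lemma geodesic_to_ray_bound a x (c : R -> X) (n t : R) : CAT0_space X ->
  0 <= n -> geodesic x (a n) c -> 0 <= t <= mdist x (a n) ->
  mdist (c t) (a t) <= 2 * mdist x (a 0).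
Proof.
move=> cX n0 gc /andP[t0 tl].
set l := mdist x (a n) in tl; set D := mdist x (a 0).
have D0 : 0 <= D by exact: mdist_ge0.
have nE : mdist (a 0) (a n) = n by rewrite ray_isometric// sub0r normrN ger0_norm.
have nl : `|n - l| <= D.
  have := (metric_triangle x (a 0) (a n), metric_triangle (a 0) x (a n)).
  rewrite nE (metric_sym (a 0) x) -/l -/D ler_norml => -[? ?].
  by apply/andP; split; lra.
have [l_eq0|l_neq0] := eqVneq l 0.
  have t_eq0 : t = 0 by lra.
  by case: (gc) => + _ _; rewrite t_eq0 => ->; rewrite -/D; lra.
have l_gt0 : 0 < l by rewrite lt0r l_neq0 mdist_ge0.
have u01 : 0 <= 1 - t / l <= 1.
  rewrite subr_ge0 ler_pdivrMr// mul1r tl/= lerBlDr lerDl divr_ge0//.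
  exact: ltW.
have := CAT0_thales cX (geodesic_rev gc) (geodesic_rev (ray_geodesic a n0)) u01.
rewrite (metric_sym (a n)) -/l (metric_sym (a n)) nE -/D.
have -> : l - (1 - t / l) * l = t by field.
have -> : n - (1 - t / l) * n = t * n / l by field.
move=> H; apply: (le_trans (metric_triangle _ (a (t * n / l)) _)).
rewrite (_ : 2 * D = D + D); last by ring.
apply: lerD; first by rewrite (le_trans H)// ler_piMl//; case/andP: u01.
rewrite ray_isometric//; last by rewrite divr_ge0 ?mulr_ge0// ltW.
have -> : t * n / l - t = t / l * (n - l) by field.
rewrite normrM ger0_norm ?divr_ge0// ?(ltW l_gt0)//.
by rewrite (le_trans _ nl)// ler_piMl// ler_pdivrMr// mul1r.
Qed.

Lemma based_ray_exists x a : proper_space X -> CAT0_space X ->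
  exists2 b : geodesic_ray X, b 0 = x & asymptotic a b.
Proof.
move=> pX cX.
have [sg sgP] : {sg : nat -> R -> X & forall n, geodesic x (a n%:R) (sg n)}.
  by apply: (@choice _ _ (fun n c => geodesic x (a n%:R) c)) => n; exact: cX.1.
set D := mdist x (a 0).
have lge n : n%:R <= mdist x (a n%:R) + D.
  rewrite -[leLHS](_ : mdist (a 0) (a n%:R) = _).
    by rewrite addrC /D (metric_sym x (a 0)) metric_triangle.
  by rewrite ray_isometric// sub0r normrN ger0_norm.
have [U [UU sU]] := ultraFilterLemma eventually_filter.
have bigU (r : R) : \forall n \near U, r <= mdist x (a n%:R).
  apply: sU; near=> n; have := lge n.
  suff : r + D <= n%:R by lra.
  by near: n; exact: nbhs_infty_ger.
have isoU (s t : R) : 0 <= s -> 0 <= t ->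
    \forall n \near U, mdist (sg n s) (sg n t) = `|s - t|.
  move=> s0 t0; near=> n; have [_ _ ->//] := sgP n.
    by apply/andP; split=> //; near: n; exact: bigU.
  by apply/andP; split=> //; near: n; exact: bigU.
have sg0 n : sg n 0 = x by have [] := sgP n.
have lim (t : R) : exists p : X, 0 <= t -> (sg n t @[n --> U]) --> p.
  have [t0|t0] := leP 0 t; last by exists x.
  have [|p [_ clp]] := pX x t (sg n t @[n --> U]) _.
    apply: filterS (isoU _ _ (lexx 0) t0) => n /=; rewrite sg0 => ->.
    by rewrite sub0r normrN ger0_norm.
  exists p => _ B pB; case: (in_ultra_setVsetC ((fun n => sg n t) @^-1` B) UU) => // UB.
  by have [q []] := clp (~` B) B UB pB.
have [b0 bP] := choice lim.
have near_b (t e : R) : 0 <= t -> 0 < e -> \forall n \near U, mdist (b0 t) (sg n t) < e.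
  by move=> t0 e0; exact: (metricType_numDomainType.cvgr_dist_lt (bP t t0)).
have b_iso s t : 0 <= s -> 0 <= t -> mdist (b0 s) (b0 t) = `|s - t|.
  move=> s0 t0; apply/eqP; rewrite eq_le; apply/andP; split.
    apply/ler_addgt0Pl => e e0; have e20 : 0 < e / 2 by lra.
    have [n [[]]] := filter_ex (filterI (filterI (near_b s _ s0 e20) (near_b t _ t0 e20)) (isoU s t s0 t0)).
    move=> h1 h2 h3.
    have := metric_triangle (b0 s) (sg n s) (b0 t).
    have := metric_triangle (sg n s) (sg n t) (b0 t).
    by rewrite (metric_sym (sg n t) (b0 t)) h3; lra.
  apply/ler_addgt0Pl => e e0; have e20 : 0 < e / 2 by lra.
  have [n [[]]] := filter_ex (filterI (filterI (near_b s _ s0 e20) (near_b t _ t0 e20)) (isoU s t s0 t0)).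
  move=> h1 h2 h3.
  have := metric_triangle (sg n s) (b0 s) (sg n t).
  have := metric_triangle (b0 s) (b0 t) (sg n t).
  by rewrite (metric_sym (sg n s) (b0 s)) h3; lra.
exists (GeodesicRay b_iso) => /=.
  apply: mdist_positivity; apply/eqP; rewrite eq_le mdist_ge0 andbT.
  apply/ler_addgt0Pl => e e0; have [n] := filter_ex (near_b 0 e (lexx 0) e0).
  by rewrite sg0 addr0 => /ltW.
exists (2 * D) => t t0 /=; apply/ler_addgt0Pl => e e0.
have [n [h1 h2]] := filter_ex (filterI (near_b t e t0 e0) (bigU t)).
have := @geodesic_to_ray_bound a x (sg n) n%:R t cX (ler0n _ _) (sgP n).
rewrite t0 h2 -/D => /(_ isT) h3.
have := metric_triangle (a t) (sg n t) (b0 t).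
by rewrite (metric_sym (a t) (sg n t)) (metric_sym (sg n t) (b0 t)); lra.
Unshelve. all: end_near.
Qed.

End rays.

Section visual_dist_theory.
Context {R : realType} {X : metricType R}.
Implicit Types (x : X) (a b : geodesic_ray X) (xi eta zeta : boundary X).

Lemma based_rayP x xi : proper_space X -> CAT0_space X ->
  based_ray x xi 0 = x /\ ray_class (based_ray x xi) = xi.
Proof.
move=> pX cX; rewrite /based_ray.
apply: (@xgetPex _ (repr xi)
  [set a : geodesic_ray X | a 0 = x /\ ray_class a = xi]).
have [b b0 ab] := based_ray_exists x (repr xi) pX cX.
by exists b; split=> //; rewrite -[RHS](@reprK _ (boundary X)); apply/esym/ray_classP.
Qed.

Lemma separation_time_unique (A : R) a b (s t : R) : CAT0_space X -> a 0 = b 0 ->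
  0 < A -> 0 < s -> 0 < t ->
  mdist (a s) (b s) = A -> mdist (a t) (b t) = A -> s = t.
Proof.
move=> cX ab A0; wlog st : s t / s <= t => [W s0 t0 sA tA|].
  by have [|/ltW] := leP s t => ?; [|symmetry]; exact: W.
move=> s0 t0 sA tA; apply/eqP; rewrite eq_le st/=.
have := @ray_dist_scale _ _ a b s t cX ab; rewrite (ltW s0) st sA tA => /(_ isT).
by rewrite ler_pM2r.
Qed.

Lemma separation_timeE (A t : R) a b : CAT0_space X -> a 0 = b 0 -> 0 < A ->
  0 < t -> mdist (a t) (b t) = A -> separation_time A a b = t%:E.
Proof.
move=> cX ab A0 t0 tA; apply: xget_unique; first by exists t.
by move=> _ [s [s0 sA] <-]; rewrite (separation_time_unique cX ab A0 s0 t0).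
Qed.

Lemma visual_distE x (A : R) a b : proper_space X -> CAT0_space X ->
  a 0 = x -> b 0 = x ->
  visual_dist x A (ray_class a) (ray_class b) = fine (separation_time A a b)^-1%E.
Proof.
move=> pX cX ax bx; have rE (c : geodesic_ray X) (t : R) : c 0 = x -> 0 <= t ->
    based_ray x (ray_class c) t = c t.
  have [r0 rc] := based_rayP x (ray_class c) pX cX => cx.
  by apply: based_ray_unique => //; [rewrite r0 cx|exact/ray_classP].
rewrite /visual_dist /separation_time; congr (fine (inve (xget _ (image _ _)))).
by apply/seteqP; split=> t /= [t0]; rewrite !rE ?ltW.
Qed.

Lemma ray_dist_continuous a b :
  continuous (fun t : R => mdist (a `|t|) (b `|t|)).
Proof.
have lip (s t : R) : mdist (a `|t|) (b `|t|) - mdist (a `|s|) (b `|s|) <= 2 * `|t - s|.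
  have := metric_triangle (a `|t|) (a `|s|) (b `|t|).
  have := metric_triangle (a `|s|) (b `|s|) (b `|t|).
  rewrite !ray_isometric// (distrC `|s|); have := ler_dist_dist t s; lra.
move=> t; apply/cvgrPdist_lt => e e0; near=> s.
have ts : `|t - s| < e / 2.
  by near: s; apply: cvgr_dist_lt => //; rewrite divr_gt0.
have := lip s t; have := lip t s; rewrite (distrC s) => h1 h2.
by rewrite ltr_norml; apply/andP; split; lra.
Unshelve. all: end_near.
Qed.

Lemma never_separated_asymptotic (A : R) a b : a 0 = b 0 -> 0 < A ->
  (forall t, 0 < t -> mdist (a t) (b t) <> A) -> asymptotic a b.
Proof.
move=> ab A0 H; exists A => t t0; rewrite leNgt; apply/negP => At.
have := @IVT R (fun t => mdist (a `|t|) (b `|t|)) 0 t A t0.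
rewrite normr0 ab mdistxx ger0_norm// => /(_ _ _)[||s].
- by apply: continuous_subspaceT; exact: ray_dist_continuous.
- by rewrite ge_min le_max (ltW A0) (ltW At) orbT.
rewrite in_itv/= => /andP[s0 _]; rewrite ger0_norm// => sA.
apply: (H s) => //; rewrite lt0r s0 andbT; apply/eqP => s_eq0.
by move: sA A0; rewrite s_eq0 ab mdistxx => <-; rewrite ltxx.
Qed.

Section axioms.
Variables (x : X) (A : R).
Hypotheses (pX : proper_space X) (cX : CAT0_space X) (A0 : 0 < A).
Let r := based_ray x.

Lemma visual_dist_cases xi eta :
  (exists2 t, 0 < t /\ mdist (r xi t) (r eta t) = A &
     visual_dist x A xi eta = t^-1) \/
  ((forall t, 0 < t -> mdist (r xi t) (r eta t) <> A) /\
     visual_dist x A xi eta = 0).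
Proof.
rewrite /visual_dist /separation_time -/r; case: xgetP => [_ -> [t [t0 tA] <-]|H].
  by left; exists t => //; rewrite inver gt_eqF.
by right; split=> // t t0 tA; apply: (H t%:E); exists t.
Qed.

Let r0 xi eta : r xi 0 = r eta 0.
Proof. by rewrite (based_rayP x xi pX cX).1 (based_rayP x eta pX cX).1. Qed.

Lemma visual_distxx xi : visual_dist x A xi xi = 0.
Proof.
have [[t [_]]|[_ ->//]] := visual_dist_cases xi xi.
by rewrite mdistxx => A_eq0; have := A0; rewrite -A_eq0 ltxx.
Qed.

Lemma visual_dist_eq0 xi eta : visual_dist x A xi eta = 0 -> xi = eta.
Proof.
have [[t [t0 _] ->]|[H _] _] := visual_dist_cases xi eta.
  by move/eqP; rewrite invr_eq0 gt_eqF.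
rewrite -(based_rayP x xi pX cX).2 -(based_rayP x eta pX cX).2.
by apply/ray_classP; apply: (@never_separated_asymptotic A).
Qed.

Lemma visual_distC xi eta : visual_dist x A xi eta = visual_dist x A eta xi.
Proof.
rewrite /visual_dist /separation_time; congr (fine (inve (xget _ (image _ _)))).
by apply/seteqP; split=> t /=; rewrite metric_sym.
Qed.

Let dist_le xi eta (t : R) : 0 < t -> t * visual_dist x A xi eta < 1 ->
  mdist (r xi t) (r eta t) <= t * visual_dist x A xi eta * A.
Proof.
move=> t0; have [[s [s0 sA] ->] ts|[_ dE] _] := visual_dist_cases xi eta.
  have ts' : t <= s by rewrite ltW// -[ltRHS]mul1r -ltr_pdivrMr.
  have := @ray_dist_scale _ _ (r xi) (r eta) t s cX (r0 _ _).
  rewrite (ltW t0) ts' sA => /(_ isT) H.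
  by rewrite mulrAC ler_pdivlMr// mulrC.
by rewrite (visual_dist_eq0 dE) mdistxx visual_distxx mulr0 mul0r.
Qed.

Lemma visual_dist_triangle eta xi zeta :
  visual_dist x A xi zeta <= visual_dist x A xi eta + visual_dist x A eta zeta.
Proof.
have ge0 xi' eta' : 0 <= visual_dist x A xi' eta'.
  have [[t [t0 _] ->]|[_ ->//]] := visual_dist_cases xi' eta'.
  by rewrite invr_ge0 ltW.
have [[t [t0 tA] ->]|[_ ->]] := visual_dist_cases xi zeta; last by rewrite addr_ge0.
rewrite leNgt; apply/negP; rewrite -(ltr_pM2l t0) divff ?gt_eqF// mulrDr => H.
have h1 := ge0 xi eta; have h2 := ge0 eta zeta.
have h3 := mulr_ge0 (ltW t0) h1; have h4 := mulr_ge0 (ltW t0) h2.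
have := metric_triangle (r xi t) (r eta t) (r zeta t); rewrite tA.
have := @dist_le xi eta t t0 ltac:(lra); have := @dist_le eta zeta t t0 ltac:(lra).
move=> k1 k2 k3.
have : (t * visual_dist x A xi eta + t * visual_dist x A eta zeta) * A < 1 * A by rewrite ltr_pM2r.
by rewrite mulrDl mul1r; lra.
Qed.

End axioms.
End visual_dist_theory.

(** * The metric space of [boundary X] with [visual_dist x0 A] *)

Section visual_boundary.
Context {R : realType} {X : metricType R}.

(* The carrier does not depend on [x0] and [A] but the metric structure does; the
   hypotheses ensure that [visual_dist] is a metric. *)
Definition visual_boundary (pX : proper_space X) (cX : CAT0_space X)
  (x0 : X) (A : R) (A0 : 0 < A) : Type := boundary X.

Variables (pX : proper_space X) (cX : CAT0_space X) (x0 : X) (A : R).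
Hypothesis A0 : 0 < A.

HB.instance Definition _ := Choice.copy (visual_boundary pX cX x0 A0) (boundary X).
HB.instance Definition _ := @isMetric.Build R (visual_boundary pX cX x0 A0)
  (visual_dist x0 A) (visual_distxx x0 A0) (visual_dist_eq0 pX cX A0)
  (visual_distC x0 A) (visual_dist_triangle x0 pX cX A0).

Lemma visual_boundary_mdistE (xi eta : visual_boundary pX cX x0 A0) :
  mdist xi eta = visual_dist x0 A xi eta.
Proof. by []. Qed.

End visual_boundary.

(** * Linearly controlled dimension *)

Section linearly_controlled_dimension.
Context {R : realType} {Y : metricType R}.
Implicit Types (y : Y) (U : set Y) (F : set (set Y)).
Local Open Scope ereal_scope.

(* [0] is adjoined because [ereal_sup set0] is [-oo]. *)
Definition diam U : \bar R :=
  ereal_sup (0 |` [set (mdist p.1 p.2)%:E | p in U `*` U]).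

Definition mesh F : \bar R := ereal_sup (0 |` diam @` F).

(* [+oo] if [S] is empty. *)
Definition set_dist y (S : set Y) : \bar R :=
  ereal_inf [set (mdist y z)%:E | z in S].

Definition lebesgue_number F : \bar R :=
  ereal_inf [set ereal_sup [set set_dist y (~` U) | U in F] | y in setT].

(* The order of [F], the least such [m], is at most [m]. *)
Definition order_le F (m : nat) : Prop :=
  forall y, ([set U | F U /\ U y] #<= `I_m)%card.

Definition open_cover F : Prop :=
  (forall U, F U -> open U) /\ \bigcup_(U in F) U = setT.

End linearly_controlled_dimension.

Definition ell_dim_le {R : realType} (Y : metricType R) (n : nat) : Prop :=
  exists c lambda0 : R, [/\ 1 <= c, 0 < lambda0 &
    forall lambda : R, 0 < lambda <= lambda0 ->
      exists F : set (set Y),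
        [/\ open_cover F, (mesh F < +oo)%E, (lambda%:E <= lebesgue_number F)%E,
            (mesh F <= (c * lambda)%:E)%E & order_le F n.+1]].

(* Main.v *)
Require Import Defs.
From HB Require Import structures.
From mathcomp Require Import all_boot all_order all_algebra.
From mathcomp Require Import all_classical all_reals all_analysis.
From mathcomp Require Import finmap ring lra.

Import Order.TTheory GRing.Theory Num.Theory.
Import numFieldNormedType.Exports.
Local Open Scope ring_scope.

(** The cover at scale [lambda] is read off from the points that the rays from
    [x0] have reached at the time [t = 1 / (4 lambda)].  Choose a maximal subset
    [S] of [X] whose points are pairwise at distance at least [A / 4], and
    for [s] in [S] let the shadow of [s] consist of the boundary points whose
    ray is at distance less than [A / 2] from [s] at the time [t].

    - Two rays through the same shadow are at distance at most [A] at the time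
      [t], so they separate no earlier than [t]: the shadow has diameter at most
      [1 / t = 4 lambda] ([visual_dist_le_inv]).
    - By the CAT(0) inequality the distance between two rays from [x0] is a
      convex function of time, so two boundary points at distance [r] with
      [t r < 1] have rays at distance at most [t r A] at the time [t]
      ([ray_dist_le_visual_dist]).  Since [S] is maximal, the ray of each
      boundary point is within [A / 4] of some [s] in [S] at the time [t], and
      the ball of radius [lambda] around that point lies in the shadow of [s]:
      it moves the ray by less than [t lambda A = A / 4].
    - The order of the cover is at most the largest number of points of [S] in a
      ball of radius [A / 2].  Because the action is cocompact and isometric,
      all these balls can be moved into one compact ball, so this number is
      bounded independently of the ball, and of [t] ([cocompact_packing]).

    The last bound is therefore a bound on the dimension. *)

Section packing.
Local Open Scope classical_set_scope.
Local Open Scope card_scope.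
Context {R : realType} {X : metricType R}.
Implicit Types (x y : X) (S C K : set X).

Definition separated (d : R) S :=
  forall s s', S s -> S s' -> s <> s' -> d <= mdist s s'.

(** The union of a chain of separated sets is separated, so Zorn's lemma gives a
    maximal one; a point far from it could be added to it. *)
Lemma separated_net (d : R) : 0 < d ->
  exists2 S, separated d S & forall x, exists2 s, S s & mdist x s < d.
Proof.
move=> d0; have [F Fsep Ftot|S [Ssep Smax]] := @Zorn_bigcup X (separated d).
  move=> s s' [B FB Bs] [B' FB' Bs']; have [BB'|B'B] := Ftot B B' FB FB'.
    by apply: (Fsep B') => //; exact: BB'.
  by apply: (Fsep B) => //; exact: B'B.
exists S => // x; apply: contrapT => far.
have xfar s : S s -> d <= mdist x s.
  by move=> Ss; rewrite leNgt; apply/negP => xs; apply: far; exists s.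
apply: (Smax (x |` S)).
  split; first by move=> s; right.
  by move=> /(_ x (or_introl erefl)) /xfar; rewrite mdistxx leNgt d0.
move=> s s' [->|Ss] [->|Ss'] // ss'; first exact: xfar.
  by rewrite metric_sym; exact: xfar.
exact: Ssep.
Qed.

Lemma compact_finite_net C (r : R) : 0 < r -> compact C ->
  exists E : {fset X}, forall x, C x -> exists2 c, c \in E & mdist c x < r.
Proof.
move=> r0; have [-> _|/set0P[x0 _]] := eqVneq C set0; first by exists fset0.
(* A point of [C] makes [X] the pointed space that [compact_cover] is about. *)
pose Xp := HB.pack_for ptopologicalType X (isPointed.Build X x0).
rewrite -[@compact _]/(@compact Xp) compact_cover => cC.
have [c _|x _|E _ CE] := cC X setT (fun c => interior (ball c r)).
- exact: open_interior.
- by exists x => //; exact: nbhsx_ballx.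
exists E => x /CE[c cE /interior_subset]; rewrite ballEmdist => xc.
by exists c.
Qed.

Lemma compact_mdist_bounded K x : compact K ->
  exists D : R, forall y, K y -> mdist x y <= D.
Proof.
move=> cK; have [E EK] := compact_finite_net K 1 ltr01 cK.
exists (\sum_(c : E) mdist x (val c) + 1) => y /EK[c cE cy].
rewrite (le_trans (metric_triangle x c y))// lerD ?(ltW cy)//.
rewrite (bigD1 [` cE]%fset)//= lerDl sumr_ge0// => *; exact: mdist_ge0.
Qed.

(** Two points of [S] in the same ball of radius [d / 2] coincide, so [S] has at
    most as many points in [C] as there are balls in a finite cover of [C]. *)
Lemma compact_packing C (d : R) : 0 < d -> compact C ->
  exists N, forall S, separated d S -> S `<=` C -> S #<= `I_N.
Proof.
move=> d0 cC; have [|E EC] := compact_finite_net C (d / 2) _ cC.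
  by rewrite divr_gt0.
exists (size E) => S Ssep SC.
have /choice[f fP] x : exists c, S x -> c \in E /\ mdist c x < d / 2.
  have [Sx|nSx] := pselect (S x); last by exists x.
  by have [c ? ?] := EC x (SC x Sx); exists c.
suff [g] : $|{injfun S >-> `I_(size E)}| by exact: inj_card_le.
apply/injfunPex; exists (fun x => index (f x) E).
  by move=> x Sx /=; rewrite index_mem; exact: (fP x Sx).1.
move=> x y /set_mem Sx /set_mem Sy fxy; apply: contrapT => xy.
have [fxE fx] := fP x Sx; have [fyE fy] := fP y Sy.
have fE : f x = f y by rewrite -(nth_index x fxE) fxy nth_index.
have := Ssep x y Sx Sy xy; have := metric_triangle x (f x) y.
by rewrite (metric_sym x (f x)) {2}fE; lra.
Qed.

(** An isometry carries a ball to a ball, and by cocompactness its centre can be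
    moved into a fixed compact set; then the ball lies in a fixed larger ball,
    which is compact. *)
Lemma cocompact_packing {G : groupType} {act : G -> X -> X} (d r : R) :
  0 < d -> proper_space X ->
  group_action act -> isometric_action act -> cocompact_action act ->
  exists N, forall S x, separated d S ->
    S `&` [set s | mdist x s < r] #<= `I_N.
Proof.
move=> d0 pX [act1 actM] iso [K cK GK].
have [[x0 _]|noX] := pselect (exists x : X, True); last first.
  by exists 0%N => S x; case: noX; exists x.
have [D KD] := compact_mdist_bounded K x0 cK.
have [N NP] := compact_packing _ d d0 (pX x0 (D + r)).
exists N => S x Ssep.
have [g _ [k Kk gk]] : (\bigcup_g (act g @` K)) x by rewrite GK.
have actK y : act g (act g^-1 y)%g = y by rewrite -actM mulgV act1.
have actVI : injective (act g^-1)%g by move=> y z /(congr1 (act g)); rewrite !actK.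
set B := _ `&` _.
rewrite -(card_le_eql (@inj_card_eq _ _ B (act g^-1)%g _)); last first.
  by move=> y z _ _; exact: actVI.
apply: NP => [_ _ [s [Ss _] <-] [s' [Ss' _] <-] ss'|_ [s [_ /= xs] <-]].
  by rewrite iso; apply: Ssep => // sE; apply: ss'; rewrite sE.
rewrite /= (le_trans (metric_triangle x0 k _))// lerD ?KD//.
by rewrite -(iso g) actK gk ltW.
Qed.

End packing.

Section shadows.
Local Open Scope classical_set_scope.
Local Open Scope card_scope.
Context {R : realType} {X : metricType R}.
Variables (pX : proper_space X) (cX : CAT0_space X).
Variables (x0 : X) (A : R).
Hypothesis A0 : 0 < A.
Local Notation bd := (visual_boundary pX cX x0 A0).
Implicit Types xi eta : bd.

Definition ray_at (t : R) xi : X := based_ray x0 xi t.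

Let ray_at_scale xi eta (s t : R) : 0 <= s <= t ->
  t * mdist (ray_at s xi) (ray_at s eta) <= s * mdist (ray_at t xi) (ray_at t eta).
Proof.
apply: ray_dist_scale => //.
by rewrite (based_rayP x0 xi pX cX).1 (based_rayP x0 eta pX cX).1.
Qed.

(** The hypothesis says that [t] is smaller than the separation time, which is
    the inverse of the distance and at which the rays are at distance [A]. *)
Lemma ray_dist_le_visual_dist xi eta (t : R) : 0 < t -> t * mdist xi eta < 1 ->
  mdist (ray_at t xi) (ray_at t eta) <= t * mdist xi eta * A.
Proof.
rewrite visual_boundary_mdistE => t0.
have [[s [s0 sA] ->] ts|[_ dE] _] := visual_dist_cases x0 A xi eta.
  have ts' : t <= s by rewrite ltW// -[ltRHS]mul1r -ltr_pdivrMr.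
  have := @ray_at_scale xi eta t s; rewrite (ltW t0) ts' /ray_at sA => /(_ isT).
  by rewrite mulrAC ler_pdivlMr// mulrC.
have -> : eta = xi by rewrite (visual_dist_eq0 pX cX A0 dE).
by rewrite mdistxx visual_distxx// mulr0 mul0r.
Qed.

Lemma visual_dist_le_inv xi eta (t : R) : 0 < t ->
  mdist (ray_at t xi) (ray_at t eta) <= A -> mdist xi eta <= t^-1.
Proof.
rewrite visual_boundary_mdistE => t0 tA.
have [[s [s0 sA] ->]|[_ ->]] := visual_dist_cases x0 A xi eta; last first.
  by rewrite invr_ge0 ltW.
rewrite lef_pV2 ?posrE//; have /orP[//|st] := le_total t s.
have := @ray_at_scale xi eta s t; rewrite (ltW s0) st /ray_at sA => /(_ isT) H.
by rewrite -(ler_pM2r A0) (le_trans H)// ler_wpM2l// ltW.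
Qed.

Definition shadow (t e : R) (s : X) : set bd :=
  [set xi | mdist (ray_at t xi) s < e].

(** A small change of the boundary point moves its ray by less than [e'] at the
    time [t].  Used with [e'] depending on [xi] for openness, and with a fixed [e']
    for the Lebesgue number. *)
Lemma shadow_ball (t e e' : R) s xi eta : 0 < t -> 0 < e' <= A ->
  mdist (ray_at t xi) s <= e - e' -> mdist xi eta < e' / (t * A) ->
  shadow t e s eta.
Proof.
move=> t0 /andP[e'0 e'A] xis xieta; rewrite /shadow/=.
have tA0 : 0 < t * A by rewrite mulr_gt0.
have H : t * mdist xi eta * A < e' by rewrite mulrAC mulrC -ltr_pdivlMr.
have H1 : t * mdist xi eta < 1.
  by rewrite -(ltr_pM2r A0) mul1r (lt_le_trans H).
have := ray_dist_le_visual_dist xi eta t t0 H1.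
have := metric_triangle (ray_at t eta) (ray_at t xi) s.
by rewrite (metric_sym _ (ray_at t xi)); lra.
Qed.

Lemma open_shadow (t e : R) s : 0 < t -> e <= A -> open (shadow t e s).
Proof.
move=> t0 eA; rewrite openE => xi xis; apply/nbhs_ballP.
set g := e - mdist (ray_at t xi) s.
have g0 : 0 < g by rewrite subr_gt0.
exists (g / (t * A)); first by rewrite /= divr_gt0// mulr_gt0.
move=> eta; rewrite ballEmdist => /=; apply: shadow_ball => //.
  rewrite g0/= (le_trans _ eA)// lerBlDr lerDl; exact: mdist_ge0.
by rewrite subKr.
Qed.

Lemma diam_shadow (t : R) s : 0 < t ->
  (diam (shadow t (A / 2) s) <= (t^-1)%:E)%E.
Proof.
move=> t0; apply: ge_ereal_sup => _ [->|[[xi eta] [/= xis etas] <-]].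
  by rewrite lee_fin invr_ge0 ltW.
rewrite lee_fin; apply: visual_dist_le_inv => //.
have := metric_triangle (ray_at t xi) s (ray_at t eta).
by move: xis etas; rewrite /shadow/= (metric_sym s); lra.
Qed.

(** The width [A / 4] between the radius of the net and the radius of the shadows
    gives the Lebesgue number, the radius [A / 2] of the shadows gives their
    diameter, and counting the net gives the order.  The count is the only
    place where the number [N] enters, so [N] bounds the dimension at all scales
    at once. *)
Lemma ell_dim_visual_boundary (N : nat) (S : set X) :
  (forall x, exists2 s, S s & mdist x s < A / 4) ->
  (forall x, S `&` [set s | mdist x s < A / 2] #<= `I_N) ->
  ell_dim_le bd N.
Proof.
move=> Snet SN; have A4 : 0 < A / 4 by rewrite divr_gt0.
exists 4, 1; split; [lra|lra|move=> l /andP[l0 _]].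
pose t := (4 * l)^-1.
have t0 : 0 < t by rewrite invr_gt0 mulr_gt0.
have tV : t^-1 = 4 * l by rewrite invrK.
have lE : l = A / 4 / (t * A).
  by rewrite /t; field; rewrite !gt_eqF.
pose F := shadow t (A / 2) @` S.
have Fmesh : (mesh F <= (4 * l)%:E)%E.
  apply: ge_ereal_sup => _ [->|[_ [s Ss <-] <-]].
    by rewrite lee_fin mulr_ge0// ltW.
  by rewrite -tV; exact: diam_shadow.
exists F; split => //.
- split=> [_ [s _ <-]|]; first by apply: open_shadow => //; lra.
  apply/seteqP; split=> // xi _; have [s Ss xis] := Snet (ray_at t xi).
  by exists (shadow t (A / 2) s); [exists s|rewrite /shadow/=; lra].
- exact: le_lt_trans Fmesh (ltry _).
- apply: le_ereal_inf_tmp => _ [xi _ <-]; apply: le_ereal_sup_tmp.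
  have [s Ss xis] := Snet (ray_at t xi).
  exists (set_dist xi (~` shadow t (A / 2) s)).
    by exists (shadow t (A / 2) s) => //; exists s.
  apply: le_ereal_inf_tmp => _ [eta Neta <-]; rewrite lee_fin leNgt lE.
  apply/negP => H; apply: Neta.
  by apply: (shadow_ball t (A / 2) (A / 4) s xi eta) => //; lra.
- move=> xi.
  (* The shadows that contain [xi] are the images of the net points near its ray,
     so there are no more of them, even if distinct points share a shadow. *)
  have -> : [set U | F U /\ U xi] =
      shadow t (A / 2) @` (S `&` [set s | mdist (ray_at t xi) s < A / 2]).
    apply/seteqP; split=> [_ [[s Ss <-] xis]|_ [s [Ss xis] <-]].
      by exists s.
    by split=> //; exists s.
  apply: card_le_trans (card_image_le _ _) (card_le_trans (SN _) _).
  by rewrite card_le_II.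
Qed.

End shadows.

Theorem theorem3p2p1 (R : realType) (X : metricType R) (G : groupType)
    (act : G -> X -> X)
    (properX : proper_space X) (CAT0X : CAT0_space X)
    (geomG : geometric_action act)
    (x0 : X) (A : R) (A_gt0 : 0 < A) :
  exists n : nat, ell_dim_le (visual_boundary properX CAT0X x0 A_gt0) n.
Proof.
have [actG iso _ coc] := geomG.
have A4 : 0 < A / 4 by rewrite divr_gt0.
have [S Ssep Snet] := @separated_net R X (A / 4) A4.
have [N NP] := cocompact_packing (A / 4) (A / 2) A4 properX actG iso coc.
exists N; apply: (@ell_dim_visual_boundary R X properX CAT0X x0 A A_gt0 N S) => // x.
exact: NP.
Qed.
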